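(* Let $N\ge 1$ be an integer and let the $q$-hypergeometric Cauchy numbers $\mathcal C_{N,k}$ be defined by $\sum_{k=0}^\infty\mathcal C_{N,k}\frac{x^k}{k!}=\left(\sum_{j=0}^\infty(-1)^j\frac{[N]_q}{[N+j]_q}x^j\right)^{-1}$. Then, as formal power series in $x$, $$\sum_{k=0}^\infty\mathcal C_{N,k}\frac{x^k}{k!}=1+\cfrac{[N]_q x}{[N+1]_q-[N]_q x+\cfrac{[N+1]_q^2 x}{[N+2]_q-[N+1]_q x+\cfrac{[N+2]_q^2 x}{[N+3]_q-[N+2]_q x+\ddots}}}.$$
   Context: $q\ne 1$ is a complex number that is not a root of unity; $[n]_q=\frac{1-q^n}{1-q}$. In the continued fraction the $j$-th partial numerator is $[N]_q x$ for $j=1$ and $[N+j-1]_q^2x$ for $j\ge2$, and the $j$-th partial denominator is $[N+j]_q-[N+j-1]_qx$. The infinite continued fraction is the limit, in the $x$-adic topology on formal power series, of its finite truncations, each truncation being a rational function of $x$ expanded as a formal power series at $x=0$. *)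

(* Defs.v *)
From mathcomp Require Import all_boot all_order all_algebra.
From mathcomp Require Import reals complex.

Set Implicit Arguments.
Unset Strict Implicit.
Unset Printing Implicit Defensive.

Import GRing.Theory.
Local Open Scope ring_scope.

Section FormalPowerSeries.
Variable F : fieldType.

(* The series \sum_n (f n) x^n is its coefficient sequence; equality of series *)
(* is equality of coefficients, written f =1 g.                                *)
Definition fps := nat -> F.

Implicit Types f g : fps.

Definition fps_one : fps := fun n => (n == 0%N)%:R.

Definition fps_of_poly (p : {poly F}) : fps := fun n => p`_n.

Definition fps_mul f g : fps := fun n => \sum_(i < n.+1) f i * g (n - i)%N.

(* [fps_inv_seq f n] lists the first n coefficients of 1 / f: the k-th one is  *)
(* determined by the coefficient of x^k in f * (1 / f) = 1.                    *)
Fixpoint fps_inv_seq f (n : nat) : seq F :=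
  if n is k.+1 then
    let s := fps_inv_seq f k in
    rcons s ((f 0%N)^-1 * (fps_one k - \sum_(i < k) f (k - i)%N * s`_i))
  else [::].

(* Meaningful only when f 0 != 0, see [fps_mulV]. *)
Definition fps_inv f : fps := fun n => (fps_inv_seq f n.+1)`_n.

Lemma size_fps_inv_seq f n : size (fps_inv_seq f n) = n.
Proof. by elim: n => //= n IHn; rewrite size_rcons IHn. Qed.

Lemma nth_fps_inv_seq f n i : (i < n)%N -> (fps_inv_seq f n)`_i = fps_inv f i.
Proof.
elim: n => // n IHn; rewrite ltnS leq_eqVlt => /predU1P[-> //|lt_in].
by rewrite [LHS]/= nth_rcons size_fps_inv_seq lt_in IHn.
Qed.

Lemma fps_mulV f : f 0%N != 0 -> fps_mul f (fps_inv f) =1 fps_one.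
Proof.
move=> f0 n; rewrite /fps_mul big_ord_recl subn0 /= {1}/fps_inv /=.
rewrite nth_rcons size_fps_inv_seq ltnn eqxx mulrA divff // mul1r.
under [X in _ - X]eq_bigr => i _ do rewrite nth_fps_inv_seq //.
rewrite [X in _ + X](reindex_inj rev_ord_inj) /=.
under [X in _ + X]eq_bigr => i _ do
  rewrite /bump add1n subnSK // subKn ?(ltnW (ltn_ord i)) //.
by rewrite subrK.
Qed.

Definition xadic_cvg (u : nat -> fps) (l : fps) : Prop :=
  forall m : nat, exists n0 : nat, forall n : nat, (n0 <= n)%N ->
    forall k : nat, (k < m)%N -> u n k = l k.

(* f is the expansion at x = 0 of the rational function r, which is required   *)
(* to be regular there: r = p / d with d(0) != 0, and d * f = p.               *)
Definition ratfun_expansion (r : {fraction {poly F}}) (f : fps) : Prop :=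
  exists p d : {poly F},
    [/\ d.[0] != 0, r = tofrac p / tofrac d
      & fps_mul (fps_of_poly d) f =1 fps_of_poly p].

End FormalPowerSeries.

Section ContinuedFraction.
Variables (F : fieldType) (b0 : {fraction {poly F}}).
Variables a b : nat -> {fraction {poly F}}.

(* a_j / (b_j + a_{j+1} / (b_{j+1} + ... + a_{j+n-1} / b_{j+n-1})) *)
Fixpoint cfrac_tail (j n : nat) : {fraction {poly F}} :=
  if n is m.+1 then a j / (b j + cfrac_tail j.+1 m) else 0.

Definition cfrac_trunc (n : nat) : {fraction {poly F}} := b0 + cfrac_tail 1 n.

(* The infinite continued fraction b0 + a_1 / (b_1 + a_2 / (b_2 + ...)) has    *)
(* value f as a formal power series.                                           *)
Definition cfrac_is_fps (f : fps F) : Prop :=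
  exists t : nat -> fps F,
    (forall n, ratfun_expansion (cfrac_trunc n) (t n)) /\ xadic_cvg t f.

End ContinuedFraction.

Section QHypergeometricCauchy.
Variables (F : fieldType) (q : F) (N : nat).

Definition qnum (n : nat) : F := (1 - q ^+ n) / (1 - q).

Definition qcauchy_denom : fps F :=
  fun j => (-1) ^+ j * (qnum N / qnum (N + j)).

Definition qcauchy (k : nat) : F := k`!%:R * fps_inv qcauchy_denom k.

Definition egf (c : nat -> F) : fps F := fun k => c k / k`!%:R.

Definition ratX : {fraction {poly F}} := tofrac 'X.
Definition ratC (c : F) : {fraction {poly F}} := tofrac c%:P.

(* Used for j >= 1 only. *)
Definition qcauchy_cf_num (j : nat) : {fraction {poly F}} :=
  if j == 1%N then ratC (qnum N) * ratX
  else ratC (qnum (N + j - 1) ^+ 2) * ratX.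

Definition qcauchy_cf_den (j : nat) : {fraction {poly F}} :=
  ratC (qnum (N + j)) - ratC (qnum (N + j - 1)) * ratX.

End QHypergeometricCauchy.

(* Main.v *)
Require Import Defs.
From mathcomp Require Import all_boot all_order all_algebra.
From mathcomp Require Import reals complex.
From mathcomp Require Import ring.
Import GRing.Theory.
Local Open Scope ring_scope.

(** Write [m_n] for the q-integer of [n],
      [D_M(x) = \sum_i (-1)^i (m_M / m_(M+i)) x^i],
    and [D_(M,n)] for the truncation of [D_M] at degree [n].  The continued
    fraction is Euler's transformation of the series [D_N]: its [n]-th truncation
    is exactly [1 / D_(N,n)] (lemma [cfrac_trunc_inv_poly]).

    The mechanism is that [D_M] reproduces itself under a shift of [M]:
      [D_(M,n+1) = 1 - (m_M / m_(M+1)) x D_(M+1,n)]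
    (lemma [cauchy_poly_rec]).  Solving this relation for [1 / D_(M,n+1)] in terms
    of [1 / D_(M+1,n)] is one layer of the continued fraction
    (lemma [euler_cf_step]).  Below the first layer the partial numerators are
    [m_M^2 x] rather than [m_M x], so that [m_M] plus the tail that follows it is
    [m_M] times the layer just described, namely [m_M / D_(M,n)]; this is the
    invariant of the induction on [n] (lemma [cfrac_tail_inv_poly]).

    It remains to pass to the limit.  Since [D_(N,n)] has constant coefficient 1,
    its inverse power series is the expansion of the [n]-th truncation.  The
    polynomial [D_(N,n)] and the series [D_N] agree up to degree [n], hence so do
    their inverses (lemma [eq_fps_inv]), and the expansions converge to [1 / D_N].
    All divisions by q-integers are legitimate because [q] is not a root of
    unity. *)

Lemma eq_fps_inv (F : fieldType) (f g : fps F) (n : nat) :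
  (forall i, (i <= n)%N -> f i = g i) -> fps_inv f n = fps_inv g n.
Proof.
rewrite /fps_inv => eq_fg.
suff -> : fps_inv_seq f n.+1 = fps_inv_seq g n.+1 by [].
have : forall i, (i < n.+1)%N -> f i = g i by [].
elim: n.+1 => // k IHk eq_fgk /=.
rewrite IHk => [|i lt_ik]; last exact/eq_fgk/ltnW.
rewrite eq_fgk //; congr (rcons _ (_ * (_ - _))).
by apply: eq_bigr => i _; rewrite eq_fgk // ltnS leq_subr.
Qed.

(** In the application [u = m_M], [v = m_(M+1)] and [s = D_(M+1,n)], so the
    right-hand side is [1 / D_(M,n+1)], and [v + t = v / s] is what the induction
    gives for the next tail [t].  It turns the denominator [v - u x + t] into
    [v / s - u x], and the left-hand side into [v / (v - u x s)]. *)
Lemma euler_cf_step (K : fieldType) (u v x s t : K) :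
  v != 0 -> s != 0 -> 1 - u / v * x * s != 0 -> v + t = v / s ->
  1 + u * x / (v - u * x + t) = (1 - u / v * x * s)^-1.
Proof.
move=> v0 s0 d0 vt.
have e0 : v - u * x * s != 0.
  suff -> : v - u * x * s = v * (1 - u / v * x * s) by rewrite mulf_neq0.
  by field.
have -> : v - u * x + t = (v - u * x * s) / s.
  by rewrite addrAC vt; field.
by field; rewrite ?v0 ?s0 ?e0 ?d0.
Qed.

Section CauchyPolynomial.
Variables (F : fieldType) (q : F).
Hypothesis qnum_neq0 : forall n, (0 < n)%N -> qnum q n != 0.

Definition cauchy_poly (M n : nat) : {poly F} :=
  \poly_(i < n.+1) qcauchy_denom q M i.

Lemma qcauchy_denom0 (M : nat) : (0 < M)%N -> qcauchy_denom q M 0 = 1.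
Proof. by move=> M0; rewrite /qcauchy_denom addn0 mul1r divff ?qnum_neq0. Qed.

Lemma cauchy_poly_deg0 (M : nat) : (0 < M)%N -> cauchy_poly M 0 = 1.
Proof.
by move=> M0; apply/polyP=> [[|i]]; rewrite coef_poly coef1 //= qcauchy_denom0.
Qed.

Lemma cauchy_poly_rec (M n : nat) : (0 < M)%N ->
  cauchy_poly M n.+1 = 1 - (qnum q M / qnum q M.+1)%:P * 'X * cauchy_poly M.+1 n.
Proof.
move=> M0; apply/polyP=> [[|i]].
  by rewrite coefB -mulrA coefCM coefXM /= mulr0 subr0 coef1 coef_poly qcauchy_denom0.
rewrite coefB -mulrA coefCM coefXM coef1 !coef_poly /= ltnS sub0r.
case: ifP => _; last by rewrite mulr0 oppr0.
rewrite /qcauchy_denom addSnnS exprS.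
by field; rewrite !qnum_neq0 // addnS.
Qed.

Lemma cauchy_poly_at0 (M n : nat) : (0 < M)%N -> (cauchy_poly M n).[0] = 1.
Proof. by move=> M0; rewrite horner_coef0 coef_poly qcauchy_denom0. Qed.

Lemma cauchy_poly_neq0 (M n : nat) : (0 < M)%N -> cauchy_poly M n != 0.
Proof.
move=> M0; apply/eqP=> /(congr1 (horner^~ 0)).
by rewrite cauchy_poly_at0 // horner0 => /eqP; rewrite oner_eq0.
Qed.

Section Truncations.
Variables (N : nat) (N_gt0 : (0 < N)%N).

Let tail := cfrac_tail (qcauchy_cf_num q N) (qcauchy_cf_den q N).

Lemma cf_layer_inv_poly (j n : nat) :
  let v := ratC (qnum q (N + j).+1) in
  v + tail j.+2 n = v / tofrac (cauchy_poly (N + j).+1 n) ->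
  1 + ratC (qnum q (N + j)) * ratX F / (qcauchy_cf_den q N j.+1 + tail j.+2 n)
    = (tofrac (cauchy_poly (N + j) n.+1))^-1.
Proof.
move=> v vE; have M0 : (0 < N + j)%N by rewrite addn_gt0 N_gt0.
have v0 : v != 0 by rewrite tofrac_eq0 polyC_eq0 qnum_neq0.
have divC (a b : F) : b != 0 -> tofrac (a / b)%:P = ratC a / ratC b.
  move=> b0; apply: (canRL (mulfK _)); first by rewrite tofrac_eq0 polyC_eq0.
  by rewrite -tofracM -polyCM divfK.
have recE : tofrac (cauchy_poly (N + j) n.+1) =
    1 - ratC (qnum q (N + j)) / v * ratX F * tofrac (cauchy_poly (N + j).+1 n).
  by rewrite cauchy_poly_rec // tofracB tofrac1 !tofracM divC // qnum_neq0.
have -> : qcauchy_cf_den q N j.+1 = v - ratC (qnum q (N + j)) * ratX F.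
  by rewrite /qcauchy_cf_den addnS subn1.
rewrite recE; apply: (euler_cf_step _ _ _ _ _ _ v0 _ _ vE).
  by rewrite tofrac_eq0 cauchy_poly_neq0.
by rewrite -recE tofrac_eq0 cauchy_poly_neq0.
Qed.

(** Adding [u] in front makes the statement self-reproducing: the partial
    numerator is [u^2 x], so [u] factors out and leaves the layer of
    [cf_layer_inv_poly].  The first partial numerator carries the q-integer
    itself and not its square, hence the restriction to positive [j]. *)
Lemma cfrac_tail_inv_poly (n j : nat) : (0 < j)%N ->
  let u := ratC (qnum q (N + j)) in
  u + tail j.+1 n = u / tofrac (cauchy_poly (N + j) n).
Proof.
elim: n j => [|n IHn] j j0 u.
  by rewrite cauchy_poly_deg0 ?addn_gt0 ?N_gt0 // /= addr0 tofrac1 divr1.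
rewrite -cf_layer_inv_poly; last by rewrite -addnS IHn.
rewrite /tail /= {1}/qcauchy_cf_num eqSS (gtn_eqF j0) addnS subn1 /=.
have sqrC (a : F) : ratC (a ^+ 2) = ratC a * ratC a.
  by rewrite -tofracM -polyCM expr2.
by rewrite sqrC mulrDr mulr1 !mulrA.
Qed.

Lemma cfrac_trunc_inv_poly (n : nat) :
  cfrac_trunc 1 (qcauchy_cf_num q N) (qcauchy_cf_den q N) n
    = (tofrac (cauchy_poly N n))^-1.
Proof.
case: n => [|n].
  by rewrite cauchy_poly_deg0 // /cfrac_trunc /= addr0 tofrac1 invr1.
have := cf_layer_inv_poly 0 n; rewrite addn0 => <- //.
by have := cfrac_tail_inv_poly n 1 isT; rewrite addn1.
Qed.

Lemma cfrac_is_fps_inv_denom :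
  cfrac_is_fps 1 (qcauchy_cf_num q N) (qcauchy_cf_den q N)
    (fps_inv (qcauchy_denom q N)).
Proof.
exists (fun n => fps_inv (fps_of_poly (cauchy_poly N n))); split=> [n|m].
  exists 1, (cauchy_poly N n); rewrite cauchy_poly_at0 ?oner_neq0 //; split=> //.
    by rewrite cfrac_trunc_inv_poly tofrac1 div1r.
  move=> k; rewrite fps_mulV /fps_of_poly ?coef1 //.
  by rewrite -horner_coef0 cauchy_poly_at0 ?oner_neq0.
exists m => n le_mn k lt_km; apply: eq_fps_inv => i le_ik.
rewrite /fps_of_poly coef_poly ltnS.
by rewrite (leq_trans le_ik) // (leq_trans (ltnW lt_km)).
Qed.

End Truncations.
End CauchyPolynomial.

Lemma qnum_neq0 (F : fieldType) (q : F) (n : nat) :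
  q != 1 -> ~~ n.-unity_root q -> qnum q n != 0.
Proof.
move=> q1 qn; rewrite mulf_neq0 ?invr_eq0 ?subr_eq0 1?eq_sym //.
by apply: contra qn => /eqP qnE; apply/unity_rootP.
Qed.

Lemma egf_qcauchy (R : numFieldType) (q : R) (N : nat) :
  egf (qcauchy q N) =1 fps_inv (qcauchy_denom q N).
Proof.
move=> k; rewrite /egf /qcauchy mulrAC divff ?mul1r //.
by rewrite Num.Theory.pnatr_eq0 -lt0n fact_gt0.
Qed.

Theorem theorem5 (R : realType) (q : R[i]) (N : nat)
  (q_neq1 : q != 1)
  (q_not_root : forall n : nat, (0 < n)%N -> ~~ n.-unity_root q)
  (N_ge1 : (1 <= N)%N) :
  cfrac_is_fps 1 (qcauchy_cf_num q N) (qcauchy_cf_den q N)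
    (egf (qcauchy q N)).
Proof.
have qnz n : (0 < n)%N -> qnum q n != 0 by move=> /q_not_root; exact: qnum_neq0.
have [t [tE t_cvg]] := cfrac_is_fps_inv_denom _ _ qnz _ N_ge1.
exists t; split=> // m; have [n0 n0P] := t_cvg m.
by exists n0 => n le_n0n k lt_km; rewrite egf_qcauchy n0P.
Qed.
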